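(* Let $\mathbb K=\mathbb Q_p$, let $\mathbb O\subset\mathbb K$ be the ring of integers, and let $g=\begin{pmatrix} a & b \\ c & d \end{pmatrix}$ be a block matrix of size $\alpha+N$ over $\mathbb K$, considered up to conjugation by $\mathrm{GL}(N,\mathbb O)$. Let $\lambda\in\mathbb P\mathbb K^1$ be a nonsingular point of the rational characteristic function $\chi_{\mathrm{pr}(g)}(\lambda)$ defined on $\mathbb P\mathbb K^1$. Let $\ell$ be the line in $\mathbb K^2$ corresponding to $\lambda$. Let a sequence of lattices $R_j\subset\mathbb K^2$ converge to $\ell$. Then $\chi_g(R_j)$ converges to $\chi_{\mathrm{pr}(g)}(\lambda)$, the latter being identified with its graph $\{\chi_{\mathrm{pr}(g)}(\lambda)p\oplus p:\ p\in\mathbb K^\alpha\}\subset\mathbb K^\alpha\oplus\mathbb K^\alpha$.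
   Context: The groups $\mathrm{GL}(N,\mathbb O)\subset\mathrm{GL}(N,\mathbb K)$ act on block matrices of size $\alpha+N$ by conjugation by $\begin{pmatrix} 1_\alpha & 0 \\ 0 & u \end{pmatrix}$; $\mathrm{pr}$ sends the $\mathrm{GL}(N,\mathbb O)$-conjugacy class of $g$ to its $\mathrm{GL}(N,\mathbb K)$-conjugacy class. The characteristic function of the latter is the rational function $\chi_{\mathrm{pr}(g)}(\lambda)=a+\lambda b(1-\lambda d)^{-1}c$ on $\mathbb P\mathbb K^1$ with values in $\mathrm{Mat}(\alpha,\mathbb K)$ (if $d$ is invertible, its value at $\lambda=\infty$ is $a-bd^{-1}c$). The line in $\mathbb K^2=\mathbb K\oplus\mathbb K$ (with coordinates $y\oplus x$) corresponding to $\lambda$ is $\{y\oplus\lambda y\}$, and $\{0\oplus x\}$ for $\lambda=\infty$. A lattice in $\mathbb K^n$ is a compact $\mathbb O$-submodule $R\subset\mathbb K^n$ such that $\mathbb K\cdot R=\mathbb K^n$. For a lattice $R\subset\mathbb K^2$ consider the lattice $R\otimes\mathbb O^N\subset\mathbb K^2\otimes\mathbb K^N=\mathbb K^N\oplus\mathbb K^N$. Then $\chi_g(R)\subset\mathbb K^\alpha\oplus\mathbb K^\alpha$ is the set of all $q\oplus p$ for which there is $y\oplus x\in R\otimes\mathbb O^N$ such that $\begin{pmatrix} q \\ y \end{pmatrix}=\begin{pmatrix} a & b \\ c & d \end{pmatrix}\begin{pmatrix} p \\ x \end{pmatrix}$; $\chi_g$ is regarded as a map from lattices in $\mathbb K^2$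 to lattices in $\mathbb K^\alpha\oplus\mathbb K^\alpha$. A sequence of lattices $R_j\subset\mathbb K^n$ converges to a subspace $L\subset\mathbb K^n$ if: (i) for each $\varepsilon>0$, for sufficiently large $j$, the lattice $R_j$ is contained in the $\varepsilon$-neighborhood of $L$; (ii) for each compact set $C\subset L$ we have $C\subset R_j\cap L$ for sufficiently large $j$.
   Formalization: ''Nonsingular point'' is taken to mean that 1−λd is invertible (d invertible for λ=∞); if poles that cancel were also allowed, the claim would fail, e.g. for α=N=1, a=c=0, b=d=1, λ=1. *)

(* Defs.v *)
From HB Require Import structures.
From mathcomp Require Import all_boot all_order all_algebra.
From mathcomp Require Import fraction generic_quotient.
From mathcomp Require Import boolp classical_sets topology.

Set Implicit Arguments.
Unset Strict Implicit.
Unset Printing Implicit Defensive.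

Import Order.TTheory GRing.Theory Num.Theory.
Local Open Scope classical_set_scope.
Local Open Scope ring_scope.

(* The ring Z_p as the inverse limit of the Z/p^n: the component of index n   *)
(* is the representative in [0, p^n) of the residue class modulo p^n.         *)
Record padic_int (p : nat) (p_pr : prime p) := PadicInt {
  pres : nat -> int;
  _ : forall n, (pres n.+1 %% p%:Z ^+ n)%Z = pres n }.
Arguments PadicInt {p p_pr pres}.

Section PadicInt.
Variables (p : nat) (p_pr : prime p).
Local Notation Zp := (padic_int p_pr).
Local Notation P n := (p%:Z ^+ n).
Implicit Types x y z : Zp.

Let P_gt0 n : 0 < P n.
Proof. by rewrite exprn_gt0 // ltz_nat prime_gt0. Qed.

Let P_neq0 n : P n != 0. Proof. by rewrite gt_eqF. Qed.

Let P_dvd m n : (m <= n)%N -> (P m %| P n)%Z.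
Proof. exact: dvdz_exp2l. Qed.

Let modP_le m n a : (m <= n)%N -> ((a %% P n)%Z %% P m)%Z = (a %% P m)%Z.
Proof.
move=> /P_dvd /dvdzP[q qE].
by rewrite [in RHS](divz_eq a (P n)) qE mulrA modzMDl -qE.
Qed.

Lemma presS x n : (pres x n.+1 %% P n)%Z = pres x n.
Proof. by case: x => f fP /=. Qed.

Lemma pres_mod x m n : (m <= n)%N -> (pres x n %% P m)%Z = pres x m.
Proof.
elim: n => [|n IHn]; first by rewrite leqn0 => /eqP->; rewrite -presS modz_mod.
rewrite leq_eqVlt ltnS => /predU1P[->|mn].
  by rewrite -presS modz_mod.
by rewrite -(modP_le _ mn) presS IHn.
Qed.

Lemma pres_inj x y : pres x =1 pres y -> x = y.
Proof.
case: x y => [f fP] [g gP] /= /funext fg; subst g.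
by congr (PadicInt _); exact: Prop_irrelevance.
Qed.

HB.instance Definition _ := gen_eqMixin Zp.
HB.instance Definition _ := gen_choiceMixin Zp.

Definition coherent (f : nat -> int) :=
  forall n, (f n.+1 = f n %[mod P n])%Z.

Lemma mkpadic_subproof f : coherent f ->
  forall n, ((f n.+1 %% P n.+1)%Z %% P n)%Z = (f n %% P n)%Z.
Proof. by move=> fP n; rewrite modP_le // fP. Qed.

Definition mkpadic f (fP : coherent f) : Zp := PadicInt (mkpadic_subproof fP).

Lemma mkpadicE f (fP : coherent f) n : pres (mkpadic fP) n = (f n %% P n)%Z.
Proof. by []. Qed.

Lemma coherent_cst a : coherent (fun=> a). Proof. by []. Qed.

Lemma coherentN x : coherent (fun n => - pres x n).
Proof. by move=> n; rewrite -modzNm presS. Qed.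

Lemma coherentD x y : coherent (fun n => pres x n + pres y n).
Proof. by move=> n; rewrite -modzDm !presS. Qed.

Lemma coherentM x y : coherent (fun n => pres x n * pres y n).
Proof. by move=> n; rewrite -modzMm !presS. Qed.

Definition padic_cst a := mkpadic (coherent_cst a).
Definition padic_opp x := mkpadic (coherentN x).
Definition padic_add x y := mkpadic (coherentD x y).
Definition padic_mul x y := mkpadic (coherentM x y).

Fact padic_addA : associative padic_add.
Proof. by move=> x y z; apply: pres_inj => n /=; rewrite modzDml modzDmr addrA. Qed.

Fact padic_addC : commutative padic_add.
Proof. by move=> x y; apply: pres_inj => n /=; rewrite addrC. Qed.

Fact padic_add0 : left_id (padic_cst 0) padic_add.
Proof. by move=> x; apply: pres_inj => n /=; rewrite modzDml add0r pres_mod. Qed.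

Fact padic_addN : left_inverse (padic_cst 0) padic_opp padic_add.
Proof. by move=> x; apply: pres_inj => n /=; rewrite modzDml addNr. Qed.

HB.instance Definition _ :=
  GRing.isZmodule.Build Zp padic_addA padic_addC padic_add0 padic_addN.

Fact padic_mulA : associative padic_mul.
Proof. by move=> x y z; apply: pres_inj => n /=; rewrite modzMml modzMmr mulrA. Qed.

Fact padic_mulC : commutative padic_mul.
Proof. by move=> x y; apply: pres_inj => n /=; rewrite mulrC. Qed.

Fact padic_mul1 : left_id (padic_cst 1) padic_mul.
Proof. by move=> x; apply: pres_inj => n /=; rewrite modzMml mul1r pres_mod. Qed.

Fact padic_mulDl : left_distributive padic_mul padic_add.
Proof.
move=> x y z; apply: pres_inj => n /=.
by rewrite modzMml modzDml modzDmr mulrDl.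
Qed.

Fact padic_1neq0 : padic_cst 1 != padic_cst 0.
Proof.
apply/eqP => /(congr1 (fun x => pres x 1)) /=.
by rewrite mod0z modz_small // expr1 ltz_nat prime_gt1.
Qed.

HB.instance Definition _ := GRing.Zmodule_isComNzRing.Build Zp
  padic_mulA padic_mulC padic_mul1 padic_mulDl padic_1neq0.

Lemma presD x y n : pres (x + y) n = ((pres x n + pres y n) %% P n)%Z.
Proof. by []. Qed.

Lemma presM x y n : pres (x * y) n = ((pres x n * pres y n) %% P n)%Z.
Proof. by []. Qed.

Lemma pres0 n : pres (0 : Zp) n = 0.
Proof. exact: mod0z. Qed.

Let padic_nz x : x != 0 -> exists n, pres x n != 0.
Proof.
move=> x0; apply: contrapT => /forallNP x_0; case/eqP: x0.
apply: pres_inj => n; rewrite pres0; apply/eqP.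
by apply: contrapT => /negP; exact: x_0.
Qed.

Definition padic_int_val x : nat :=
  if pselect (exists n, pres x n != 0) is left ex then (ex_minn ex).-1 else 0.

Lemma pres_eq0 x n : x != 0 -> (pres x n == 0) = (n <= padic_int_val x)%N.
Proof.
move=> /padic_nz ex; rewrite /padic_int_val; case: pselect => // {}ex.
case: ex_minnP => -[|m] xm mmin; first by rewrite -presS expr0 modz1 in xm.
rewrite /= leqNgt -/(m < n)%N; apply/idP/idP => [/eqP xn|].
  by apply: contra xm => mn; rewrite -(pres_mod _ mn) xn mod0z.
by apply: contraR; exact: mmin.
Qed.

Let pres_fact x n : x != 0 -> (padic_int_val x < n)%N ->
  exists2 a, pres x n = a * P (padic_int_val x) & ~~ (p %| a)%Z.
Proof.
move=> x0 vn; set v := padic_int_val x in vn *.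
have /dvdz_mod0P/dvdzP[a aE] : (pres x n %% P v = 0)%Z.
  by rewrite pres_mod 1?ltnW //; apply/eqP; rewrite pres_eq0.
exists a => //; apply/negP => pa.
suff : pres x v.+1 == 0 by rewrite pres_eq0 // ltnn.
rewrite -(pres_mod _ vn) aE; apply/eqP/dvdz_mod0P.
by rewrite exprS dvdz_mul.
Qed.

Let presM_eq0 x y (n := (padic_int_val x + padic_int_val y)%N) :
  x != 0 -> y != 0 -> pres (x * y) n = 0 /\ pres (x * y) n.+1 != 0.
Proof.
move=> x0 y0.
have [a aE pa] : exists2 a, pres x n.+1 = a * P (padic_int_val x) & ~~ (p %| a)%Z.
  by apply: pres_fact; rewrite // ltnS leq_addr.
have [b bE pb] : exists2 b, pres y n.+1 = b * P (padic_int_val y) & ~~ (p %| b)%Z.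
  by apply: pres_fact; rewrite // ltnS leq_addl.
have E : pres (x * y) n.+1 = (a * b * P n %% P n.+1)%Z.
  by rewrite presM aE bE mulrACA -exprD.
split; first by rewrite -presS E modP_le // modzMl.
rewrite E; apply/eqP => /dvdz_mod0P.
rewrite exprS dvdz_mul2r // dvdzE abszM Euclid_dvdM //.
by move: pa pb; rewrite !dvdzE /= => /negPf-> /negPf->.
Qed.

Definition padic_int_unit : pred Zp := [pred x | `[< exists y, y * x = 1 >]].

Definition padic_int_inv x : Zp :=
  if pselect (exists y, y * x = 1) is left ex then sval (cid ex) else x.

Fact padic_int_mulV : {in padic_int_unit, left_inverse 1 padic_int_inv *%R}.
Proof.
move=> x /asboolP ex; rewrite /padic_int_inv; case: pselect => // {}ex.
exact: svalP (cid ex).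
Qed.

Fact padic_int_unitP x y : y * x = 1 -> padic_int_unit x.
Proof. by move=> yx; apply/asboolP; exists y. Qed.

Fact padic_int_inv_out :
  {in [predC padic_int_unit], padic_int_inv =1 id}.
Proof.
move=> x /asboolP xu; rewrite /padic_int_inv; by case: pselect.
Qed.

HB.instance Definition _ := GRing.ComNzRing_hasMulInverse.Build Zp
  padic_int_mulV padic_int_unitP padic_int_inv_out.

Fact padic_int_mulf_eq0 x y : x * y = 0 -> (x == 0) || (y == 0).
Proof.
move=> xy; apply/norP => -[x0 y0].
by have [_] := presM_eq0 x0 y0; rewrite xy pres0 eqxx.
Qed.

HB.instance Definition _ :=
  GRing.ComUnitRing_isIntegral.Build Zp padic_int_mulf_eq0.

Lemma padic_int_valM x y : x != 0 -> y != 0 ->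
  padic_int_val (x * y) = (padic_int_val x + padic_int_val y)%N.
Proof.
move=> x0 y0; have [/eqP xy0 xy1] := presM_eq0 x0 y0.
have xy : x * y != 0 by rewrite mulf_neq0.
apply/eqP; rewrite eqn_leq -pres_eq0 // xy0 andbT leqNgt.
by rewrite -pres_eq0.
Qed.

Definition padic_int_norm x : rat :=
  if x == 0 then 0 else p%:R ^- padic_int_val x.

Lemma padic_int_norm_ge0 x : 0 <= padic_int_norm x.
Proof. by rewrite /padic_int_norm; case: eqP => _; rewrite ?invr_ge0 ?exprn_ge0. Qed.

Lemma padic_int_norm_eq0 x : (padic_int_norm x == 0) = (x == 0).
Proof.
rewrite /padic_int_norm; case: (eqVneq x 0) => [|_]; rewrite ?eqxx //.
by rewrite invr_eq0 expf_eq0 pnatr_eq0 (gtn_eqF (prime_gt0 p_pr)) andbF.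
Qed.

Lemma padic_int_normM : {morph padic_int_norm : x y / x * y}.
Proof.
move=> x y; rewrite /padic_int_norm mulf_eq0.
have [->|x0] := eqVneq x 0; first by rewrite /= mul0r.
have [->|y0] := eqVneq y 0; first by rewrite orbT mulr0.
by rewrite /= padic_int_valM // exprD invfM.
Qed.

Lemma pres_norm x n : (pres x n == 0) = (padic_int_norm x <= p%:R ^- n).
Proof.
rewrite /padic_int_norm; have [->|x0] := eqVneq x 0.
  by rewrite pres0 eqxx invr_ge0 exprn_ge0.
have p0 : (0 : rat) < p%:R by rewrite ltr0n prime_gt0.
rewrite pres_eq0 // lef_pV2 ?posrE ?exprn_gt0 // ler_eXn2l //.
by rewrite ltr1n prime_gt1.
Qed.

Lemma padic_int_normD x y :
  padic_int_norm (x + y) <= Num.max (padic_int_norm x) (padic_int_norm y).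
Proof.
wlog le_xy : x y / padic_int_norm x <= padic_int_norm y.
  move=> H; have [|/ltW] := leP (padic_int_norm x) (padic_int_norm y).
    by move=> le_xy; rewrite -(max_idPr le_xy) H.
  by move=> le_yx; rewrite addrC -(max_idPr le_yx) H.
rewrite (max_idPr le_xy).
have [y0|y0] := eqVneq y 0.
  move: le_xy; rewrite y0 addr0 //.
have yE : padic_int_norm y = p%:R ^- padic_int_val y.
  by rewrite /padic_int_norm (negPf y0).
rewrite yE in le_xy *; rewrite -pres_norm presD.
move: le_xy; rewrite -pres_norm => /eqP->.
by rewrite add0r pres_mod // pres_eq0.
Qed.

Lemma padic_int_normN x : padic_int_norm (- x) = padic_int_norm x.
Proof.
have [->|x0] := eqVneq x 0; first by rewrite oppr0.
suff n1 : padic_int_norm (-1) = 1 by rewrite -mulN1r padic_int_normM n1 mul1r.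
have : padic_int_norm (-1) ^+ 2 = 1 ^+ 2.
  rewrite expr2 -padic_int_normM mulrNN mulr1 expr1n.
  apply: (@mulfI _ (padic_int_norm x)); rewrite ?padic_int_norm_eq0 //.
  by rewrite -padic_int_normM !mulr1.
by move/eqP; rewrite eqrXn2 ?padic_int_norm_ge0 // => /eqP.
Qed.

End PadicInt.

Section Padic.
Variables (p : nat) (p_pr : prime p).

(* The field Q_p. *)
Definition padic := {fraction padic_int p_pr}.

HB.instance Definition _ := GRing.Field.on padic.

Local Notation "x %:F" := (@FracField.tofrac (padic_int p_pr) x).
Implicit Types (x y z : padic) (a b d : padic_int p_pr).

Definition padic_norm x : rat :=
  padic_int_norm (\n_(repr x)) / padic_int_norm (\d_(repr x)).

Lemma padic_numden x : x = (\n_(repr x))%:F / (\d_(repr x))%:F.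
Proof.
have d0 := denom_ratioP (repr x).
apply: (mulIf (_ : (\d_(repr x))%:F != 0)); first by rewrite tofrac_eq0.
rewrite divfK ?tofrac_eq0 // -[x in LHS]reprK !piE.
apply/eqmodP; rewrite /= FracField.equivfE /FracField.mulf !numden_Ratio ?oner_neq0 ?mulr1 //.
by rewrite reprK mulrC.
Qed.

Lemma padic_norm_frac a d : d != 0 ->
  padic_norm (a%:F / d%:F) = padic_int_norm a / padic_int_norm d.
Proof.
move=> d0; set x := a%:F / d%:F; rewrite /padic_norm.
have d'0 := denom_ratioP (repr x).
apply/eqP; rewrite eqr_div ?padic_int_norm_eq0 // -!padic_int_normM; apply/eqP.
congr padic_int_norm; apply/eqP; rewrite -tofrac_eq !tofracM.
by rewrite -eqr_div ?tofrac_eq0 // -padic_numden.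
Qed.

Lemma padic_common_denom x y : exists a b d,
  [/\ d != 0, x = a%:F / d%:F & y = b%:F / d%:F].
Proof.
have xd := denom_ratioP (repr x); have yd := denom_ratioP (repr y).
exists (\n_(repr x) * \d_(repr y)), (\n_(repr y) * \d_(repr x)).
exists (\d_(repr x) * \d_(repr y)); rewrite mulf_neq0 // !tofracM; split=> //.
  by rewrite -mulf_div divff ?tofrac_eq0 // mulr1 -padic_numden.
by rewrite [X in _ / X]mulrC -mulf_div divff ?tofrac_eq0 // mulr1 -padic_numden.
Qed.

Lemma padic_norm_eq0 x : (padic_norm x == 0) = (x == 0).
Proof.
have [a [_ [d [d0 -> _]]]] := padic_common_denom x x.
rewrite padic_norm_frac // !mulf_eq0 !invr_eq0 !padic_int_norm_eq0 tofrac_eq0.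
by rewrite tofrac_eq0.
Qed.

Lemma padic_normM : {morph padic_norm : x y / x * y}.
Proof.
move=> x y; have [a [b [d [d0 -> ->]]]] := padic_common_denom x y.
rewrite mulf_div -!tofracM !padic_norm_frac ?mulf_neq0 //.
by rewrite !padic_int_normM mulf_div.
Qed.

Lemma padic_normN x : padic_norm (- x) = padic_norm x.
Proof.
have [a [_ [d [d0 -> _]]]] := padic_common_denom x x.
by rewrite -mulNr -tofracN !padic_norm_frac // padic_int_normN.
Qed.

Lemma padic_norm_ge0 x : 0 <= padic_norm x.
Proof. by rewrite divr_ge0 ?padic_int_norm_ge0. Qed.

Lemma padic_normD x y :
  padic_norm (x + y) <= Num.max (padic_norm x) (padic_norm y).
Proof.
have [a [b [d [d0 -> ->]]]] := padic_common_denom x y.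
rewrite -mulrDl -tofracD !padic_norm_frac // -maxr_pMl.
  by rewrite ler_wpM2r ?padic_int_normD // invr_ge0 padic_int_norm_ge0.
by rewrite invr_ge0 padic_int_norm_ge0.
Qed.

(* The p-adic absolute value takes rational values, so the metric is valued in rat. *)
Definition padic_dist x y := padic_norm (x - y).

Fact padic_distxx x : padic_dist x x = 0.
Proof. by apply/eqP; rewrite padic_norm_eq0 subrr. Qed.

Fact padic_dist_eq0 x y : padic_dist x y = 0 -> x = y.
Proof. by move/eqP; rewrite padic_norm_eq0 subr_eq0 => /eqP. Qed.

Fact padic_dist_sym x y : padic_dist x y = padic_dist y x.
Proof. by rewrite /padic_dist -padic_normN opprB. Qed.

Fact padic_dist_triangle y x z :
  padic_dist x z <= padic_dist x y + padic_dist y z.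
Proof.
rewrite /padic_dist -(subrKA y x (- z)) (le_trans (padic_normD _ _)) //.
by rewrite ge_max lerDl lerDr !padic_norm_ge0.
Qed.

HB.instance Definition _ := isMetric.Build rat padic
  padic_distxx padic_dist_eq0 padic_dist_sym padic_dist_triangle.

HB.instance Definition _ := isPointed.Build padic 0.

(* The ring of integers of Q_p. *)
Definition padicO : set padic := [set x | padic_norm x <= 1].

Lemma padicO0 : padicO 0.
Proof. by rewrite /padicO /= (eqP (_ : padic_norm 0 == 0)) ?padic_norm_eq0. Qed.

Lemma padicO1 : padicO 1.
Proof.
have n1 : padic_norm 1 != 0 by rewrite padic_norm_eq0 oner_neq0.
by rewrite /padicO /= -[leLHS](mulfK n1) -padic_normM mulr1 divff.
Qed.

Lemma padicOD x y : padicO x -> padicO y -> padicO (x + y).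
Proof.
rewrite /padicO /= => x1 y1.
by rewrite (le_trans (padic_normD _ _)) // ge_max x1 y1.
Qed.

Lemma padicOM x y : padicO x -> padicO y -> padicO (x * y).
Proof. by rewrite /padicO /= => x1 y1; rewrite padic_normM mulr_ile1 ?padic_norm_ge0. Qed.

End Padic.

(* Points of the projective line: [Some l] is l in F, [None] is infinity. *)
Definition proj_line (F : fieldType) : Type := option F.

Section Characteristic.
Variables (F : fieldType) (alpha N : nat).
Implicit Types (g : 'M[F]_(alpha + N)) (u : 'M[F]_N) (lambda : proj_line F).

(* The inverse in a + lambda b (1 - lambda d)^-1 c must exist: a point where    *)
(* 1 - lambda d is singular but the poles cancel in the product is not counted  *)
(* as nonsingular. At such a point the limit statement fails: for alpha = N = 1,*)
(* a = c = 0, b = d = 1, the product vanishes identically, but [chi_map] below  *)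
(* sends the lattice spanned by p^-j (1 (+) 1) and p^j (0 (+) 1) to             *)
(* p^-j O (+) K, while these lattices converge to the line of lambda = 1.       *)
Definition chi_nonsingular g lambda : bool :=
  if lambda is Some l then 1%:M - l *: drsubmx g \in unitmx
  else drsubmx g \in unitmx.

(* At infinity, lambda (1 - lambda d)^-1 = (lambda^-1 - d)^-1 becomes - d^-1. *)
Definition chi g lambda : 'M[F]_alpha :=
  if lambda is Some l then
    ulsubmx g + l *: (ursubmx g *m invmx (1%:M - l *: drsubmx g) *m dlsubmx g)
  else ulsubmx g - ursubmx g *m invmx (drsubmx g) *m dlsubmx g.

Definition graph_of (A : 'M[F]_alpha) : set 'cV[F]_(alpha + alpha) :=
  [set col_mx (A *m v) v | v in setT].

Definition conj_block u g : 'M[F]_(alpha + N) :=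
  block_mx 1%:M 0 0 u *m g *m invmx (block_mx 1%:M 0 0 u).

Lemma conj_blockE u (a : 'M[F]_alpha) (b : 'M[F]_(alpha, N)) c d :
  u \in unitmx ->
  conj_block u (block_mx a b c d) =
  block_mx a (b *m invmx u) (u *m c) (u *m d *m invmx u).
Proof.
move=> uu; set U : 'M[F]_(alpha + N) := block_mx 1%:M 0 0 u.
have UU : U *m block_mx 1%:M 0 0 (invmx u) = 1%:M.
  rewrite mulmx_block !mulmx0 !mul0mx !mulmx1 addr0 !add0r mulmxV //.
  by rewrite -scalar_mx_block.
have [Uu _] := mulmx1_unit UU.
have -> : conj_block u (block_mx a b c d) =
    U *m block_mx a b c d *m block_mx 1%:M 0 0 (invmx u).
  by rewrite /conj_block -/U -[in RHS](mulKmx Uu (block_mx _ _ _ (invmx u))) UU mulmx1.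
by rewrite !mulmx_block !mulmx0 !mul0mx !mul1mx !mulmx1 !addr0 !add0r.
Qed.

Lemma conj_block_col u g (q r : 'cV[F]_alpha) y x : u \in unitmx ->
  col_mx q (u *m y) = conj_block u g *m col_mx r (u *m x) <->
  col_mx q y = g *m col_mx r x.
Proof.
move=> uu; rewrite -[g]submxK; move: (ulsubmx g) (ursubmx g) (dlsubmx g) (drsubmx g).
move=> a b c d; rewrite conj_blockE // !mul_block_col.
rewrite !mulmxA !mulmxKV // -!mulmxA -mulmxDr; split=> /eq_col_mx[-> E].
  by congr col_mx; rewrite -(mulKmx uu y) E mulKmx.
by rewrite E.
Qed.

Lemma chi_nonsingular_conj u g lambda : u \in unitmx ->
  chi_nonsingular (conj_block u g) lambda = chi_nonsingular g lambda.
Proof.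
move=> uu; rewrite -[g]submxK; move: (ulsubmx g) (ursubmx g) (dlsubmx g) (drsubmx g).
move=> a b c d; rewrite conj_blockE // /chi_nonsingular.
case: lambda => [l|]; rewrite !block_mxKdr.
  have -> : 1%:M - l *: (u *m d *m invmx u) =
            u *m (1%:M - l *: d) *m invmx u.
    by rewrite mulmxBr mulmxBl mulmx1 mulmxV // -scalemxAr -scalemxAl.
  by rewrite !unitmx_mul unitmx_inv uu andbT.
by rewrite !unitmx_mul unitmx_inv uu andbT.
Qed.

Lemma chi_conj u g lambda : u \in unitmx -> chi_nonsingular g lambda ->
  chi (conj_block u g) lambda = chi g lambda.
Proof.
move=> uu; have invC (A : 'M[F]_N) : A \in unitmx ->
    invmx (u *m A *m invmx u) = u *m invmx A *m invmx u.
  move=> Au; have E : u *m A *m invmx u *m (u *m invmx A *m invmx u) = 1%:M.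
    by rewrite !mulmxA mulmxKV // mulmxK // mulmxV.
  by have [U _] := mulmx1_unit E; rewrite -[RHS](mulKmx U) E mulmx1.
have simp (B : 'M[F]_(alpha, N)) (A : 'M[F]_N) (C : 'M[F]_(N, alpha)) :
    B *m invmx u *m (u *m A *m invmx u) *m (u *m C) = B *m A *m C.
  by rewrite !mulmxA !mulmxKV.
rewrite -[g]submxK; move: (ulsubmx g) (ursubmx g) (dlsubmx g) (drsubmx g).
move=> a b c d; rewrite conj_blockE // /chi_nonsingular /chi.
case: lambda => [l|]; rewrite !(block_mxKul, block_mxKur, block_mxKdl, block_mxKdr).
  have -> : 1%:M - l *: (u *m d *m invmx u) =
            u *m (1%:M - l *: d) *m invmx u.
    by rewrite mulmxBr mulmxBl mulmx1 mulmxV // -scalemxAr -scalemxAl.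
  by move=> du; rewrite invC // simp.
by move=> du; rewrite invC // simp.
Qed.

End Characteristic.

Section Lattices.
Variables (p : nat) (p_pr : prime p).
Local Notation K := (padic p_pr).
Local Notation O := (@padicO p p_pr).

Definition O_submodule n (R : set 'cV[K]_n) :=
  [/\ R 0,
      forall u v, R u -> R v -> R (u + v)
    & forall k u, O k -> R u -> R (k *: u)].

Definition lattice n (R : set 'cV[K]_n) :=
  [/\ compact R, O_submodule R
    & forall v, exists k r, R r /\ v = k *: r].

Definition eps_neighborhood n (L : set 'cV[K]_n) (eps : rat) : set 'cV[K]_n :=
  \bigcup_(l in L) ball l eps.

(* Stated for arbitrary subsets: [chi_map g R] below need not be compact, nor *)
(* span, even if R is a lattice (take b = 0 and c = 0).                       *)
Definition converges_to n (R : nat -> set 'cV[K]_n) (L : set 'cV[K]_n) :=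
  (forall eps : rat, 0 < eps ->
     \forall j \near \oo, R j `<=` eps_neighborhood L eps) /\
  (forall C : set 'cV[K]_n, compact C -> C `<=` L ->
     \forall j \near \oo, C `<=` R j `&` L).

(* y (+) x in K^2 *)
Definition col2 (y x : K) : 'cV[K]_2 := \col_i (if i == 0 then y else x).

(* (y (+) x) (x) v in K^2 (x) K^N, identified with K^N (+) K^N *)
Definition pure_tensor N (r : 'cV[K]_2) (v : 'cV[K]_N) : 'cV[K]_(N + N) :=
  col_mx (r 0 0 *: v) (r 1 0 *: v).

Definition tensor_lattice (R : set 'cV[K]_2) N : set 'cV[K]_(N + N) :=
  [set w | exists m (r : 'I_m -> 'cV[K]_2) (v : 'I_m -> 'cV[K]_N),
     [/\ forall k, R (r k), forall k i, O (v k i 0)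
       & w = \sum_(k < m) pure_tensor (r k) (v k)]].

Lemma tensor_latticeP (R : set 'cV[K]_2) N (y x : 'cV[K]_N) : O_submodule R ->
  tensor_lattice R (col_mx y x) <-> forall i, R (col2 (y i 0) (x i 0)).
Proof.
move=> [R0 RD RZ]; split=> [[m [r [v [Rr Ov E]]]] i|Ryx].
  suff -> : col2 (y i 0) (x i 0) = \sum_(k < m) v k i 0 *: r k.
    by elim/big_ind: _ => // k _; exact: RZ.
  have Ey : y i 0 = \sum_(k < m) v k i 0 * r k 0 0.
    rewrite -[y](col_mxKu _ x) E linear_sum summxE; apply: eq_bigr => k _.
    by rewrite /pure_tensor /= col_mxKu mxE mulrC.
  have Ex : x i 0 = \sum_(k < m) v k i 0 * r k 1 0.
    rewrite -[x](col_mxKd y) E linear_sum summxE; apply: eq_bigr => k _.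
    by rewrite /pure_tensor /= col_mxKd mxE mulrC.
  apply/matrixP => j l; rewrite ord1 mxE summxE.
  case: (unliftP 0 j) => [j' ->|->]; rewrite /= ?ord1 ?Ey ?Ex;
    by apply: eq_bigr => k _; rewrite mxE //; congr (_ * r k _ _); apply: val_inj.
exists N, (fun i => col2 (y i 0) (x i 0)), (fun i => delta_mx i 0); split=> //.
  move=> k i; rewrite mxE; case: (_ && _); [exact: padicO1|exact: padicO0].
have sumE (z : 'cV[K]_N) : z = \sum_(k < N) z k 0 *: delta_mx k 0.
  by rewrite [LHS]matrix_sum_delta; apply: eq_bigr => k _; rewrite big_ord1.
apply/esym; rewrite [in RHS](sumE y) [in RHS](sumE x).
elim/big_rec3: _ => [|k A B C _ ->]; first by rewrite col_mx0.
by rewrite /pure_tensor !mxE /= add_col_mx.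
Qed.

Definition line_of (lambda : proj_line K) : set 'cV[K]_2 :=
  if lambda is Some l then [set col2 y (l * y) | y in setT]
  else [set col2 0 x | x in setT].

Section ChiMap.
Variables alpha N : nat.
Implicit Types (g : 'M[K]_(alpha + N)) (u : 'M[K]_N).

(* The relation [q; y] = g [p; x] with y (+) x in R (x) O^N. *)
Definition chi_map g (R : set 'cV[K]_2) : set 'cV[K]_(alpha + alpha) :=
  [set w | exists (q p : 'cV[K]_alpha) (y x : 'cV[K]_N),
     [/\ w = col_mx q p, tensor_lattice R (col_mx y x)
       & col_mx q y = g *m col_mx p x]].

(* GL(N, O); by the lemmas below, [chi] and [chi_nonsingular] only depend on the *)
(* GL(N, K)-conjugacy class of g, and [chi_map] on its GL(N, O)-conjugacy class. *)
Definition GL_O u :=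
  [/\ u \in unitmx, forall i j, O (u i j) & forall i j, O (invmx u i j)].

Lemma chi_map_conj u g R : GL_O u -> chi_map (conj_block u g) R = chi_map g R.
Proof.
move=> [uu Ou Ov].
have tens (h : 'M[K]_N) y x : (forall i j, O (h i j)) ->
    tensor_lattice R (col_mx y x) -> tensor_lattice R (col_mx (h *m y) (h *m x)).
  move=> Oh [m [r [v [Rr Ovv E]]]]; exists m, r, (fun k => h *m v k); split=> //.
    move=> k i; rewrite mxE; elim/big_ind: _ => [|? ?|j _].
    - exact: padicO0.
    - exact: padicOD.
    - exact: padicOM.
  have -> : col_mx (h *m y) (h *m x) = block_mx h 0 0 h *m col_mx y x.
    by rewrite mul_block_col !mul0mx addr0 add0r.
  rewrite E mulmx_sumr; apply: eq_bigr => k _.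
  by rewrite mul_block_col !mul0mx addr0 add0r -!scalemxAr.
apply/seteqP; split=> w [q [v [y [x [-> T E]]]]]; last first.
  by exists q, v, (u *m y), (u *m x); split; [|exact: tens|exact/conj_block_col].
exists q, v, (invmx u *m y), (invmx u *m x); split=> //; first exact: tens.
by apply/(conj_block_col _ _ _ _ _ uu); rewrite !(mulKVmx uu).
Qed.

End ChiMap.
End Lattices.

(* Main.v *)
Require Import Defs.
From mathcomp Require Import all_boot all_order all_algebra.
From mathcomp Require Import boolp classical_sets topology.

Set Implicit Arguments.
Unset Strict Implicit.
Unset Printing Implicit Defensive.

Import Order.TTheory GRing.Theory Num.Theory.
Local Open Scope classical_set_scope.
Local Open Scope ring_scope.

(** Write the points of the line as [s z (+) t z], with [(s, t) = (1, lambda)],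
or [(0, -1)] at infinity. If [y (+) x] is such a point coordinatewise up to an
error [e (+) f], then [y = c p + d x] can be solved for [z], because [s - t d]
is invertible, and [q = a p + b x] becomes the value of the characteristic
function at [p] plus a fixed linear function of [e (+) f]. With zero error this
represents every point of the graph exactly, and the coordinates of [y (+) x]
are then continuous functions of that point, so they stay in a compact subset
of the line. *)

Section BlockSolve.
Variables (F : fieldType) (m n : nat).
Variables (a : 'M[F]_m) (b : 'M[F]_(m, n)) (c : 'M[F]_(n, m)) (d : 'M[F]_n).
Variables (s t : F).
Let M := s%:M - t *: d.
Hypothesis Mu : M \in unitmx.
Implicit Types (q v : 'cV[F]_m) (z e f : 'cV[F]_n).

(** The lower block row determines [z], and the upper row is then evaluated at that [z]. The
    coefficient of [col_mx e f] does not involve [v], which makes the later estimate uniform over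
    the unbounded graph. *)
Lemma block_mx_col_error q v z e f :
  col_mx q (s *: z + e) = block_mx a b c d *m col_mx v (t *: z + f) ->
  q = (a + t *: (b *m invmx M *m c)) *m v +
    row_mx (- (t *: (b *m invmx M))) (t *: (b *m invmx M *m d) + b) *m col_mx e f.
Proof.
rewrite mul_block_col => /eq_col_mx[-> cE].
(* The lower row reads [s z + e = c v + d (t z + f)]; collecting [z] gives [M z = c v + d f - e]. *)
have zE : z = invmx M *m (c *m v + d *m f - e).
  apply: (canRL (mulKmx Mu)); rewrite /M mulmxBl mul_scalar_mx -scalemxAl.
  move/(canRL (addrK _)): cE => ->.
  by rewrite mulmxDr -scalemxAr addrAC [t *: _ + _]addrC addrA addrK.
rewrite mul_row_col mulmxDr -scalemxAr {1}zE !mulmxDl mulNmx.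
rewrite -!scalemxAl !mulmxA mulmxBr mulmxDr !mulmxA scalerBr scalerDr.
by rewrite -!addrA; congr (_ + (_ + _)); rewrite addrCA.
Qed.

(** This [z] solves the lower row [M z = c v] without error. *)
Lemma block_mx_col_exact v (z := invmx M *m c *m v) :
  col_mx ((a + t *: (b *m invmx M *m c)) *m v) (s *: z) =
  block_mx a b c d *m col_mx v (t *: z).
Proof.
rewrite mul_block_col -!scalemxAr; congr col_mx.
  by rewrite mulmxDl -scalemxAl !mulmxA.
apply/eqP; rewrite -subr_eq scalemxAl -mul_scalar_mx -mulmxBl.
by rewrite /z -mulmxA mulKVmx.
Qed.

End BlockSolve.

Section PadicVectors.
Variables (p : nat) (p_pr : prime p).
Local Notation K := (padic p_pr).

(** The conjunct [0 < e] adds something only for [n = 0], where the coordinate condition is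
    vacuous. *)
Lemma ball_cVE n (u v : 'cV[K]_n) (e : rat) :
  ball u e v <-> 0 < e /\ forall i, padic_norm (u i 0 - v i 0) < e.
Proof.
split=> -[e0 H]; split=> // i; first exact: (H i 0).
by move=> j; rewrite ord1; exact: H.
Qed.

Lemma ball_cV_sub n (u v : 'cV[K]_n) (e : rat) :
  ball u e v <-> ball (0 : 'cV[K]_n) e (v - u).
Proof.
rewrite !ball_cVE; split=> -[e0 H]; split=> // i; have := H i;
  by rewrite !mxE sub0r opprB.
Qed.

(** By the ultrametric inequality the bound does not grow with the number of terms; [0 < e] covers
    the empty sum. *)
Lemma padic_norm_sum (I : Type) (r : seq I) (F : I -> K) (e : rat) : 0 < e ->
  (forall i, padic_norm (F i) < e) ->
  padic_norm (\sum_(i <- r) F i) < e.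
Proof.
move=> e0 Fe; elim/big_ind: _ => // [|x y xe ye].
  by rewrite (eqP (_ : padic_norm (0 : K) == 0)) // padic_norm_eq0.
by rewrite (le_lt_trans (padic_normD _ _)) // gt_max xe.
Qed.

Lemma mulmx_ball0 m n (A : 'M[K]_(m, n)) (eps : rat) : 0 < eps ->
  exists2 del : rat, 0 < del &
    forall v : 'cV[K]_n, ball (0 : 'cV[K]_n) del v -> ball (0 : 'cV[K]_m) eps (A *m v).
Proof.
(* A crude bound for all entries of [A]; the summand [1] keeps [k] positive, so that [eps / k] can
   serve as [del]. *)
move=> eps0; pose k := 1 + \sum_i \sum_j padic_norm (A i j).
have Ak i j : padic_norm (A i j) <= k.
  rewrite /k (bigD1 i) //= (bigD1 j) //= -!addrA [1 + _]addrCA lerDl.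
  rewrite addr_ge0 // addr_ge0 ?sumr_ge0 // => *; rewrite ?sumr_ge0 // => *;
    exact: padic_norm_ge0.
have k0 : 0 < k.
  by rewrite ltr_pwDl ?sumr_ge0 // => *; rewrite sumr_ge0 // => *; exact: padic_norm_ge0.
exists (eps / k); first by rewrite divr_gt0.
move=> v /ball_cVE[_ H]; apply/ball_cVE; split=> // i.
rewrite mxE sub0r padic_normN mxE; apply: padic_norm_sum => // j.
have := H j; rewrite mxE sub0r padic_normN ltr_pdivlMr // => vj.
rewrite padic_normM mulrC (le_lt_trans _ vj) // ler_wpM2l ?padic_norm_ge0 //.
Qed.

Lemma mulmx_continuous m n (A : 'M[K]_(m, n)) :
  continuous (fun v : 'cV[K]_n => A *m v).
Proof.
move=> u; apply/(@cvg_ballP _ _ _ _ (nbhs_filter u)) => eps eps0.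
have [del del0 H] := mulmx_ball0 A eps0.
apply/nbhs_ballP; exists del => //= v uv.
apply/(ball_cV_sub (A *m u) _ _).2; rewrite -mulmxBr; exact/H/(ball_cV_sub u _ _).1.
Qed.

End PadicVectors.

Section HomogeneousPoint.
Variables (p : nat) (p_pr : prime p) (alpha N : nat).
Local Notation K := (padic p_pr).
Variables (a : 'M[K]_alpha) (b : 'M[K]_(alpha, N)).
Variables (c : 'M[K]_(N, alpha)) (d : 'M[K]_N) (s t : K).
Let g := block_mx a b c d.
Let M : 'M[K]_N := s%:M - t *: d.
Let X : 'M[K]_alpha := a + t *: (b *m invmx M *m c).
Let L : set 'cV[K]_2 := [set col2 (s * z) (t * z) | z in setT].
Hypothesis Mu : M \in unitmx.

(** A point [q (+) v] of [chi_map g R] is compared with the graph point over the same [v]; they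
    differ by a fixed matrix applied to the error, so [del] can be chosen before [R]. *)
Lemma chi_map_neighborhood (eps : rat) : 0 < eps ->
  exists2 del : rat, 0 < del & forall R : set 'cV[K]_2,
    O_submodule R -> R `<=` eps_neighborhood L del ->
    chi_map g R `<=` eps_neighborhood (graph_of X) eps.
Proof.
move=> eps0.
pose G := row_mx (- (t *: (b *m invmx M))) (t *: (b *m invmx M *m d) + b).
(* The zero block reflects that the two points share their second component. *)
have [del del0 H] := mulmx_ball0 (col_mx G (0 : 'M_(alpha, N + N))) eps0.
exists del => // R RO RL w [q [v [y [x [-> /tensor_latticeP-/(_ RO) T E]]]]].
(* Membership in [tensor_lattice R] is coordinatewise, so a nearby point of the line is picked for
   each [i] separately and the parameters form one vector [z]. *)
have near_line i : exists z,
    ball (col2 (s * z) (t * z)) del (col2 (y i 0) (x i 0)).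
  by have [_ [z _ <-] zB] := RL _ (T i); exists z.
have [zf zfP] := choice near_line.
pose z : 'cV[K]_N := \col_i zf i.
pose e := y - s *: z; pose f := x - t *: z.
exists (col_mx (X *m v) v); first by exists v.
apply: (ball_cV_sub _ _ _).2.
have ef : ball (0 : 'cV[K]_(N + N)) del (col_mx e f).
  apply/ball_cVE; split=> // i; rewrite mxE sub0r padic_normN.
  case: (split_ordP i) => k ->; rewrite (col_mxEu, col_mxEd).
    have /ball_cVE[_ /(_ 0)] := zfP k.
    by rewrite !mxE eqxx -padic_normN opprB.
  have /ball_cVE[_ /(_ 1)] := zfP k.
  by rewrite !mxE /= -padic_normN opprB.
have qE : q = X *m v + G *m col_mx e f.
  apply: (block_mx_col_error Mu (_ : col_mx q (s *: z + e) = g *m col_mx v (t *: z + f))).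
  by rewrite /e /f !subrKC.
have -> : col_mx q v - col_mx (X *m v) v =
    col_mx G (0 : 'M_(alpha, N + N)) *m col_mx e f.
  rewrite mul_col_mx mul0mx opp_col_mx add_col_mx subrr; congr col_mx.
  by rewrite qE addrC addKr.
exact: H.
Qed.

Lemma compact_subset_chi_map (R : nat -> set 'cV[K]_2) (C : set 'cV[K]_(alpha + alpha)) :
  (forall j, O_submodule (R j)) ->
  (forall D, compact D -> D `<=` L -> \forall j \near \oo, D `<=` R j) ->
  compact C -> C `<=` graph_of X ->
  \forall j \near \oo, C `<=` chi_map g (R j).
Proof.
move=> RO RL cC CX.
(* [Z] reads [v] off the graph point [X v (+) v] and returns the exact solution [z]; [A i] sends
   that point to [s z_i (+) t z_i] in [L]. *)
pose Z := invmx M *m c *m (row_mx 0 1%:M : 'M_(alpha, alpha + alpha)).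
pose A i := col2 s t *m row i Z.
have AE i w : A i *m w = col2 (s * (Z *m w) i 0) (t * (Z *m w) i 0).
  apply/matrixP => k l; rewrite ord1 /A -mulmxA -row_mul !mxE big_ord1 !mxE.
  by case: eqP.
have AC i : \forall j \near \oo, (fun w => A i *m w) @` C `<=` R j.
  apply: RL; last by move=> _ [w _ <-]; rewrite AE; exists ((Z *m w) i 0).
  apply: continuous_compact cC; apply: continuous_subspaceT.
  exact: mulmx_continuous.
(* There are finitely many rows [i], so one threshold on [j] serves them all. *)
have {}AC : \forall j \near \oo, forall i, (fun w => A i *m w) @` C `<=` R j.
  exact: filter_forall.
near=> j => w Cw; have [v _ wE] := CX _ Cw.
have Aj := near AC j _; have {Aj} : forall i, R j (A i *m w).
  by move=> i; apply: Aj => //; exists w.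
have ZwE : Z *m w = invmx M *m c *m v.
  by rewrite -wE /Z -mulmxA mul_row_col mul0mx add0r mul1mx.
move=> RA; set z := Z *m w in ZwE.
exists (X *m v), v, (s *: z), (t *: z); split; first by rewrite wE.
  apply/tensor_latticeP => // i; have := RA i.
  by rewrite AE -/z; congr (R j (col2 _ _)); rewrite [in RHS]mxE.
by rewrite ZwE; exact: block_mx_col_exact.
Unshelve. all: by end_near.
Qed.

Lemma chi_map_converges (R : nat -> set 'cV[K]_2) :
  (forall j, O_submodule (R j)) ->
  converges_to R L ->
  converges_to (fun j => chi_map g (R j)) (graph_of X).
Proof.
move=> RO [RL LR]; split=> [eps eps0|C cC CX].
  have [del del0 H] := chi_map_neighborhood eps0.
  by apply: filterS (RL _ del0) => j; exact: H.
have LR' D : compact D -> D `<=` L -> \forall j \near \oo, D `<=` R j.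
  by move=> cD DL; apply: filterS (LR D cD DL) => j DR x /DR[].
apply: filterS (compact_subset_chi_map RO LR' cC CX) => j CR w Cw.
by split; [exact: CR|exact: CX].
Qed.

End HomogeneousPoint.

Theorem proposition4p4 (p : nat) (p_pr : prime p) (alpha N : nat)
    (g : 'M[padic p_pr]_(alpha + N)) (lambda : proj_line (padic p_pr))
    (R : nat -> set 'cV[padic p_pr]_2) :
  chi_nonsingular g lambda ->
  (forall j, lattice (R j)) ->
  converges_to R (line_of lambda) ->
  converges_to (fun j => chi_map g (R j)) (graph_of (chi g lambda)).
Proof.
move=> ns Rlat; have RO j : O_submodule (R j) by have [] := Rlat j.
case: lambda ns => [l|] ns RL.
  (* For [(s, t) = (1, l)], [M] and [X] are literally the expressions in [chi_nonsingular] and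
     [chi]. *)
  rewrite -{1}[g]submxK; apply: chi_map_converges => //.
  rewrite (_ : [set _ | _ in _] = line_of (Some l)) //.
  by apply: eq_imagel => z _; rewrite mul1r.
(* At infinity, [t = -1] gives both [M = d] and the minus sign in [a - b d^-1 c]. *)
have ME : (0 : padic p_pr)%:M - (-1) *: drsubmx g = drsubmx g.
  by rewrite raddf0 sub0r scaleN1r opprK.
have -> : chi g None = ulsubmx g + (-1) *: (ursubmx g *m
    invmx ((0 : padic p_pr)%:M - (-1) *: drsubmx g) *m dlsubmx g).
  by rewrite ME scaleN1r.
rewrite -{1}[g]submxK; apply: chi_map_converges; rewrite ?ME //.
rewrite (_ : [set _ | _ in _] = line_of None) //.
(* Since [t = -1], the two parametrizations of the line at infinity differ by a sign. *)
apply/seteqP; split=> _ [z _ <-]; exists (- z) => //.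
  by rewrite mul0r mulN1r.
by rewrite mul0r mulN1r opprK.
Qed.
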